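(* Let $G$ be a Deza graph with strongly regular children and adjacency matrix $$M=\begin{pmatrix} M_{11} & M_{12}\\ M_{21} & M_{22}\end{pmatrix},$$ where the vertices are ordered so that $M_{11}$ is the adjacency matrix of an induced subgraph $H$ of $G$. Suppose there exists a Seidel automorphism of $H$ with permutation matrix $P_{11}$ such that $P_{11}M_{11}M_{12}=M_{11}M_{12}$. Let $P=\begin{pmatrix} P_{11} & 0\\ 0 & I\end{pmatrix}$. Then the matrices $$N_1=\begin{pmatrix} P_{11}M_{11} & M_{12}\\ M_{21} & M_{22}\end{pmatrix},\qquad N_2=\begin{pmatrix} P_{11}M_{11} & P_{11}M_{12}\\ M_{21}P_{11} & M_{22}\end{pmatrix}$$ are adjacency matrices of Deza graphs with strongly regular children. Moreover, $N_1^2=M^2$ and $N_2^2=(PMP)^2$.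
   Context: A strongly regular graph with parameters $(n,k,\lambda,\mu)$ is a $k$-regular graph on $n$ vertices in which any two distinct adjacent vertices have exactly $\lambda$ common neighbours and any two distinct non-adjacent vertices have exactly $\mu$ common neighbours. A Deza graph with parameters $(n,k,b,a)$, $b\ge a$, is a $k$-regular connected graph on $n$ vertices such that any two distinct vertices have either $b$ or $a$ common neighbours; equivalently its adjacency matrix $N$ satisfies $N^2=aA+bB+kI$ for symmetric $(0,1)$-matrices $A,B$ with $A+B+I=J$ ($J$ the all-ones matrix). The graphs with adjacency matrices $A$ and $B$ are the children of the Deza graph; ''Deza graph with strongly regular children'' means both children are strongly regular graphs. A Seidel automorphism of a graph is an involutive automorphism $\varphi$ ($\varphi^2=\mathrm{id}$, $\varphi\ne\mathrm{id}$) such that for every vertex $v$ with $\varphi(v)\neq v$, $v$ and $\varphi(v)$ are non-adjacent; its permutation matrix $P_{11}$ has $(P_{11})_{u,v}=1$ iff $v=\varphi(u)$.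
   Formalization: That N1 and N2 are adjacency matrices of Deza graphs is claimed only when H is not all of G or G is not bipartite; for H = G = C_6 with the antipodal map, N1 is two disjoint triangles, hence not connected. The identities for the squares are unrestricted. *)

(* Defs.v *)
From HB Require Import structures.
From mathcomp Require Import all_boot all_order all_fingroup all_algebra.

Set Implicit Arguments.
Unset Strict Implicit.
Unset Printing Implicit Defensive.

Import GRing.Theory.
Local Open Scope ring_scope.

(* A graph on n vertices is a relation on 'I_n satisfying [simple_graph]. *)

Definition simple_graph (n : nat) (e : rel 'I_n) : Prop :=
  symmetric e /\ irreflexive e.

Definition adjmx (n : nat) (e : rel 'I_n) : 'M[int]_n :=
  \matrix_(u, v) (e u v)%:R.

Definition degree (n : nat) (e : rel 'I_n) (u : 'I_n) : nat :=
  #|[set w | e u w]|.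

Definition common_neighbours (n : nat) (e : rel 'I_n) (u v : 'I_n) : nat :=
  #|[set w | e u w && e v w]|.

Definition regular (n : nat) (k : nat) (e : rel 'I_n) : Prop :=
  forall u, degree e u = k.

Definition connected_graph (n : nat) (e : rel 'I_n) : Prop :=
  forall u v, connect e u v.

(* Switching with H = G may disconnect a bipartite graph: for G = C_6 and phi
   the antipodal map, P11 *m M11 is the adjacency matrix of two triangles, which
   is not a Deza graph since Deza graphs are connected. *)
Definition bipartite (n : nat) (e : rel 'I_n) : Prop :=
  exists c : 'I_n -> bool, forall u v, e u v -> c u != c v.

Definition strongly_regular_with (n k lam mu : nat) (e : rel 'I_n) : Prop :=
  [/\ simple_graph e,
      regular k e,
      forall u v, u != v -> e u v -> common_neighbours e u v = lam
    & forall u v, u != v -> ~~ e u v -> common_neighbours e u v = mu].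

Definition strongly_regular (n : nat) (e : rel 'I_n) : Prop :=
  exists k lam mu : nat, strongly_regular_with k lam mu e.

Definition deza_graph (n k b a : nat) (e : rel 'I_n) : Prop :=
  [/\ simple_graph e /\ connected_graph e,
      regular k e,
      (a <= b)%N
    & forall u v, u != v ->
        common_neighbours e u v = b \/ common_neighbours e u v = a].

(* The pair (eA, eB) is determined by e, k, b, a unless a = b. *)
Definition children (n k b a : nat) (e eA eB : rel 'I_n) : Prop :=
  [/\ simple_graph eA,
      simple_graph eB,
      adjmx e *m adjmx e
        = a%:R *: adjmx eA + b%:R *: adjmx eB + k%:R *: 1%:M
    & adjmx eA + adjmx eB + 1%:M = const_mx 1].

Definition deza_with_src (n : nat) (e : rel 'I_n) : Prop :=
  exists (k b a : nat) (eA eB : rel 'I_n),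
    [/\ deza_graph k b a e,
        children k b a e eA eB,
        strongly_regular eA
      & strongly_regular eB].

Definition adjmx_of_deza_with_src (n : nat) (N : 'M[int]_n) : Prop :=
  exists e : rel 'I_n, N = adjmx e /\ deza_with_src e.

Definition automorphism (n : nat) (e : rel 'I_n) (phi : {perm 'I_n}) : Prop :=
  forall u v, e (phi u) (phi v) = e u v.

Definition seidel_automorphism (n : nat) (e : rel 'I_n) (phi : {perm 'I_n})
    : Prop :=
  [/\ automorphism e phi,
      forall v, phi (phi v) = v,
      exists v, phi v != v
    & forall v, phi v != v -> ~~ e v (phi v)].

(* The subgraph induced on the first p vertices. *)
Definition induced_left (p q : nat) (e : rel 'I_(p + q)) : rel 'I_p :=
  fun u v => e (lshift q u) (lshift q v).

(* Main.v *)
Require Import Defs.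
From mathcomp Require Import all_boot all_fingroup all_algebra.

Set Implicit Arguments.
Unset Strict Implicit.
Unset Printing Implicit Defensive.

Import GRing.Theory.
Local Open Scope ring_scope.

(** Since [P11] is an involution commuting with [M11], blockwise multiplication
    and [P11 *m M11 *m M12 = M11 *m M12] give [N1 ^ 2 = M ^ 2].  The entries of
    the square of an adjacency matrix are the numbers of common neighbours, so
    the switched graph has the same degree, Deza parameters and children as [G].
    Only connectedness is not determined by the square.  Walks of even length
    are: if [G] is connected and not bipartite any two vertices are joined by
    one; if there is a vertex outside [H], its neighbourhood is not changed by
    the switching, and a walk of odd length to it consists of one of its edges
    and a walk of even length.  Finally [N2 = P *m N1 *m P], so [N2] is the
    adjacency matrix of an isomorphic graph. *)

Lemma permV_involutive (T : finType) (s : {perm T}) :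
  involutive s -> (s^-1)%g = s.
Proof.
by move=> sK; apply/permP => x; apply: (@perm_inj _ s); rewrite permKV sK.
Qed.

Lemma perm_mx_involutive (R : pzSemiRingType) n (s : {perm 'I_n}) :
  involutive s -> perm_mx s *m perm_mx s = 1%:M :> 'M[R]_n.
Proof.
by move=> sK; rewrite -perm_mxM -{1}(permV_involutive sK) mulVg perm_mx1.
Qed.

Section AdjacencyMatrix.

Variable n : nat.
Implicit Types (e f : rel 'I_n) (phi : {perm 'I_n}) (u v : 'I_n).

Lemma tr_adjmx e : symmetric e -> (adjmx e)^T = adjmx e.
Proof. by move=> se; apply/matrixP => u v; rewrite !mxE se. Qed.

Lemma adjmx_sqE e u v : symmetric e ->
  (adjmx e *m adjmx e) u v = (common_neighbours e u v)%:R.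
Proof.
move=> se; rewrite mxE /common_neighbours -sum1dep_card natr_sum.
rewrite [RHS]big_mkcond; apply: eq_bigr => w _.
by rewrite !mxE (se w v) -natrM mulnb; case: (_ && _).
Qed.

Lemma eq_common_neighbours_sq e f : symmetric e -> symmetric f ->
  adjmx e *m adjmx e = adjmx f *m adjmx f ->
  common_neighbours e =2 common_neighbours f.
Proof.
move=> se sf /matrixP eq_sq u v; have := eq_sq u v.
by rewrite !adjmx_sqE // => /eqP; rewrite Num.Theory.eqr_nat => /eqP.
Qed.

Lemma common_neighboursxx e u : common_neighbours e u u = degree e u.
Proof. by apply: eq_card => w; rewrite !inE andbb. Qed.

Lemma common_neighboursC e u v :
  common_neighbours e u v = common_neighbours e v u.
Proof. by apply: eq_card => w; rewrite !inE andbC. Qed.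

Lemma adjmx_relpre phi e :
  adjmx (relpre phi e) = perm_mx phi *m adjmx e *m perm_mx phi^-1.
Proof.
by rewrite -row_permE -col_permE; apply/matrixP => u v; rewrite !mxE.
Qed.

Lemma automorphism_comm_mx e phi :
  automorphism e phi -> comm_mx (perm_mx phi) (adjmx e).
Proof.
move=> phiA; have : adjmx (relpre phi e) = adjmx e.
  by apply/matrixP => u v; rewrite !mxE /= phiA.
rewrite adjmx_relpre /comm_mx => adjE.
by rewrite -[in RHS]adjE -!mulmxA -perm_mxM mulVg perm_mx1 mulmx1.
Qed.

End AdjacencyMatrix.

Section TwoStep.

Variable n : nat.
Implicit Types e f : rel 'I_n.

Definition two_step e : rel 'I_n := fun u v => (0 < common_neighbours e u v)%N.

Lemma two_step_path e x y z : symmetric e -> e x z -> e z y -> two_step e x y.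
Proof. by move=> se xz zy; apply/card_gt0P; exists z; rewrite inE xz se. Qed.

Lemma two_step_sym e : symmetric (two_step e).
Proof. by move=> u v; rewrite /two_step common_neighboursC. Qed.

Lemma connect_two_step_sub e : symmetric e ->
  subrel (connect (two_step e)) (connect e).
Proof.
move=> se; apply: connect_sub => u v /card_gt0P[w]; rewrite inE (se v).
by case/andP=> uw wv; apply: connect_trans (connect1 uw) (connect1 wv).
Qed.

Lemma connect_parity e x y : symmetric e -> connect e x y ->
  connect (two_step e) x y \/ exists2 z, connect (two_step e) x z & e z y.
Proof.
move=> se /connectP[s]; elim/last_ind: s y => [|s z IHs] y /=.
  by move=> _ ->; left.
rewrite rcons_path last_rcons => /andP[path_s last_z] ->.
have [x_last|[t xt t_last]] := IHs _ path_s erefl.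
  by right; exists (last x s).
by left; apply: connect_trans xt (connect1 (two_step_path se t_last last_z)).
Qed.

Lemma connect_two_step_edge e x u v : symmetric e -> connect e x u -> e u v ->
  connect (two_step e) x u || connect (two_step e) x v.
Proof.
move=> se xu uv; apply/orP; have [|[z xz zu]] := connect_parity se xu.
  by left.
by right; apply: connect_trans xz (connect1 (two_step_path se zu uv)).
Qed.

(* Colour each vertex by whether an even walk joins it to [x]: if no even walk
   joins [x] to [y], the colouring is proper. *)
Lemma connected_two_step e : symmetric e -> connected_graph e ->
  ~ bipartite e -> connected_graph (two_step e).
Proof.
move=> se ce nbip x y; apply/negPn/negP => /negP not_xy.
apply: nbip; exists (connect (two_step e) x) => u v uv.
apply/negP => /eqP eq_uv.
have xu : connect (two_step e) x u.
  by have := connect_two_step_edge se (ce x u) uv; rewrite -eq_uv orbb.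
have xv : connect (two_step e) x v by rewrite -eq_uv.
have two_stepC := sym_connect_sym (two_step_sym e).
case/orP: (connect_two_step_edge se (ce y u) uv); rewrite two_stepC => to_y.
  exact: not_xy (connect_trans xu to_y).
exact: not_xy (connect_trans xv to_y).
Qed.

Lemma eq_connect_two_step_sq e f : symmetric e -> symmetric f ->
  adjmx e *m adjmx e = adjmx f *m adjmx f ->
  connect (two_step e) =2 connect (two_step f).
Proof.
move=> se sf eq_sq; apply: eq_connect => u v.
by rewrite /two_step (eq_common_neighbours_sq se sf eq_sq).
Qed.

Lemma connected_graph_sq_nonbipartite e f : symmetric e -> symmetric f ->
  adjmx e *m adjmx e = adjmx f *m adjmx f -> connected_graph e ->
  ~ bipartite e -> connected_graph f.
Proof.
move=> se sf eq_sq ce nbip u v; apply: connect_two_step_sub => //.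
by rewrite -(eq_connect_two_step_sq se sf eq_sq); apply: connected_two_step.
Qed.

Lemma connected_graph_sq_neighbourhood e f w : symmetric e -> symmetric f ->
  adjmx e *m adjmx e = adjmx f *m adjmx f -> connected_graph e ->
  e w =1 f w -> connected_graph f.
Proof.
move=> se sf eq_sq ce eq_w.
have to_w x : connect f x w.
  have [|[z]] := connect_parity se (ce x w);
    rewrite (eq_connect_two_step_sq se sf eq_sq);
    move/(connect_two_step_sub sf) => //.
  by rewrite se eq_w sf => xz /connect1; apply: connect_trans xz.
by move=> u v; apply: connect_trans (to_w u) _; rewrite (sym_connect_sym sf).
Qed.

End TwoStep.

Lemma deza_with_src_simple_connected n (e : rel 'I_n) :
  deza_with_src e -> simple_graph e /\ connected_graph e.
Proof. by case=> k [b [a [eA [eB [[]]]]]]. Qed.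

Lemma deza_graph_sq n k b a (e f : rel 'I_n) :
  simple_graph f -> connected_graph f ->
  adjmx e *m adjmx e = adjmx f *m adjmx f ->
  deza_graph k b a e -> deza_graph k b a f.
Proof.
move=> gf cf eq_sq [[ge _] reg ab cn].
have cnE := eq_common_neighbours_sq ge.1 gf.1 eq_sq.
split=> // [u|u v uv]; last by rewrite -cnE; apply: cn.
by rewrite -common_neighboursxx -cnE common_neighboursxx.
Qed.

Lemma deza_with_src_sq n (e f : rel 'I_n) :
  simple_graph f -> connected_graph f ->
  adjmx e *m adjmx e = adjmx f *m adjmx f ->
  deza_with_src e -> deza_with_src f.
Proof.
move=> gf cf eq_sq [k [b [a [eA [eB [dz [gA gB sqE J] srA srB]]]]]].
exists k, b, a, eA, eB; split=> //; first exact: deza_graph_sq dz.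
by split=> //; rewrite -eq_sq.
Qed.

Lemma simple_graph_relpre m n (h : 'I_m -> 'I_n) (e : rel 'I_n) :
  simple_graph e -> simple_graph (relpre h e).
Proof. by case=> se ie; split=> [u v|u]; [apply: se | apply: ie]. Qed.

Section Relabelling.

Variables (n : nat) (s : {perm 'I_n}).
Implicit Types e : rel 'I_n.

Lemma common_neighbours_relpre e u v :
  common_neighbours (relpre s e) u v = common_neighbours e (s u) (s v).
Proof.
rewrite /common_neighbours -[RHS](card_preimset _ (@perm_inj _ s)).
by apply: eq_card => w; rewrite !inE.
Qed.

Lemma regular_relpre k e : regular k e -> regular k (relpre s e).
Proof.
move=> reg u; rewrite -common_neighboursxx common_neighbours_relpre.
by rewrite common_neighboursxx.
Qed.

Lemma connected_graph_relpre e :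
  connected_graph e -> connected_graph (relpre s e).
Proof.
move=> ce u v; have /connectP[t] := ce (s u) (s v).
rewrite -(mapK (permKV s) t) path_map last_map => path_t /perm_inj last_t.
by apply/connectP; exists (map (s^-1)%g t).
Qed.

Lemma strongly_regular_relpre e :
  strongly_regular e -> strongly_regular (relpre s e).
Proof.
move=> [k [lam [mu [ge reg adj nonadj]]]]; exists k, lam, mu; split.
- exact: simple_graph_relpre.
- exact: regular_relpre.
- move=> u v uv; rewrite common_neighbours_relpre.
  by apply: adj; rewrite (inj_eq perm_inj).
- move=> u v uv; rewrite common_neighbours_relpre.
  by apply: nonadj; rewrite (inj_eq perm_inj).
Qed.

Lemma deza_graph_relpre k b a e :
  deza_graph k b a e -> deza_graph k b a (relpre s e).
Proof.
case=> [[ge ce] reg ab cn]; split=> //.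
- by split; [apply: simple_graph_relpre | apply: connected_graph_relpre].
- exact: regular_relpre.
- move=> u v uv; rewrite !common_neighbours_relpre.
  by apply: cn; rewrite (inj_eq perm_inj).
Qed.

Lemma children_relpre k b a e eA eB : symmetric e ->
  children k b a e eA eB ->
  children k b a (relpre s e) (relpre s eA) (relpre s eB).
Proof.
move=> se [gA gB sq J]; split; try exact: simple_graph_relpre.
- apply/matrixP => u v; rewrite adjmx_sqE; last by move=> x y; apply: se.
  by rewrite common_neighbours_relpre -adjmx_sqE // sq !mxE (inj_eq perm_inj).
- apply/matrixP => u v; have /matrixP/(_ (s u) (s v)) := J.
  by rewrite !mxE (inj_eq perm_inj).
Qed.

Lemma deza_with_src_relpre e : deza_with_src e -> deza_with_src (relpre s e).
Proof.
move=> [k [b [a [eA [eB [dz ch srA srB]]]]]].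
exists k, b, a, (relpre s eA), (relpre s eB).
split; try exact: strongly_regular_relpre; first exact: deza_graph_relpre.
by apply: children_relpre => //; case: dz => [[[]]].
Qed.

End Relabelling.

Section PermSum.

Variables p q : nat.
Implicit Types (s : {perm 'I_p}) (t : {perm 'I_q}).

Definition perm_sum_fun s t (u : 'I_(p + q)) : 'I_(p + q) :=
  match split u with inl i => lshift q (s i) | inr j => rshift p (t j) end.

Lemma perm_sum_fun_lshift s t i :
  perm_sum_fun s t (lshift q i) = lshift q (s i).
Proof. by rewrite /perm_sum_fun (unsplitK (inl i)). Qed.

Lemma perm_sum_fun_rshift s t j :
  perm_sum_fun s t (rshift p j) = rshift p (t j).
Proof. by rewrite /perm_sum_fun (unsplitK (inr j)). Qed.

Definition perm_sum_funE := (perm_sum_fun_lshift, perm_sum_fun_rshift).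

Lemma perm_sum_fun_inj s t : injective (perm_sum_fun s t).
Proof.
apply: (can_inj (g := perm_sum_fun s^-1 t^-1)) => u.
by case: (split_ordP u) => i ->; rewrite !perm_sum_funE permK.
Qed.

Definition perm_sum s t : {perm 'I_(p + q)} := perm (@perm_sum_fun_inj s t).

Lemma perm_mx_sum (R : pzSemiRingType) s t :
  perm_mx (perm_sum s t)
    = block_mx (perm_mx s) 0 0 (perm_mx t) :> 'M[R]_(p + q).
Proof.
apply/matrixP => u v; rewrite !mxE permE.
case: (split_ordP u) => i ->; rewrite perm_sum_funE mxE;
  by case: (split_ordP v) => j ->; rewrite !mxE ?eq_shift.
Qed.

Lemma perm_sum_involutive s t :
  involutive s -> involutive t -> involutive (perm_sum s t).
Proof.
move=> sK tK u; rewrite !permE.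
by case: (split_ordP u) => i ->; rewrite !perm_sum_funE ?sK ?tK.
Qed.

End PermSum.

Lemma conj_mx_mul (R : pzSemiRingType) m n (P : 'M[R]_(m, n))
    (Q : 'M[R]_(n, m)) (X Y : 'M[R]_n) :
  Q *m P = 1%:M -> P *m X *m Q *m (P *m Y *m Q) = P *m (X *m Y) *m Q.
Proof. by move=> QP; rewrite !mulmxA -(mulmxA _ Q P) QP mulmx1. Qed.

Section SwitchedMatrix.

Variables (R : pzSemiRingType) (p q : nat).
Implicit Types (P A : 'M[R]_p) (B : 'M[R]_(p, q)).
Implicit Types (C : 'M[R]_(q, p)) (D : 'M[R]_q).

Lemma switched_block_mx_sq P A B C D :
  P *m P = 1%:M -> comm_mx P A ->
  P *m A *m B = A *m B -> C *m A *m P = C *m A ->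
  block_mx (P *m A) B C D *m block_mx (P *m A) B C D
    = block_mx A B C D *m block_mx A B C D.
Proof.
move=> PP PA PAB CAP.
rewrite !mulmx_block PAB -(mulmxA P A) (mulmxA A P) -PA !mulmxA PP mul1mx.
by rewrite -(mulmxA C P) PA mulmxA CAP.
Qed.

Lemma conj_switched_block_mx P A B C D :
  P *m P = 1%:M -> comm_mx P A ->
  block_mx P 0 0 1%:M *m block_mx (P *m A) B C D *m block_mx P 0 0 1%:M
    = block_mx (P *m A) (P *m B) (C *m P) D.
Proof.
move=> PP PA.
rewrite !mulmx_block !mulmx0 !mul0mx !mulmx1 !mul1mx !addr0 !add0r.
by rewrite mulmxA PP mul1mx PA.
Qed.

End SwitchedMatrix.

Lemma adjmx_induced_left p q (e : rel 'I_(p + q)) A B C D :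
  adjmx e = block_mx A B C D -> adjmx (induced_left e) = A.
Proof.
move=> eE; rewrite -(block_mxKul A B C D) -eE.
by apply/matrixP => i j; rewrite !mxE.
Qed.

Definition dual_seidel_switch n (phi : {perm 'I_n}) (e : rel 'I_n) : rel 'I_n :=
  fun u v => e (phi u) v.

Lemma simple_graph_dual_seidel_switch n (phi : {perm 'I_n}) (e : rel 'I_n) :
  simple_graph e -> seidel_automorphism e phi ->
  simple_graph (dual_seidel_switch phi e).
Proof.
move=> [se ie] [phiA phiK _ nadj]; rewrite /dual_seidel_switch.
split=> [u v|u]; first by rewrite -phiA phiK se.
have [->|/nadj] := eqVneq (phi u) u; first exact: ie.
by rewrite se => /negbTE.
Qed.

Definition generalised_dual_seidel_switch p q (phi : {perm 'I_p})
    (e : rel 'I_(p + q)) : rel 'I_(p + q) := fun u v =>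
  match split u, split v with
  | inl i, inl j => dual_seidel_switch phi (induced_left e) i j
  | _, _ => e u v
  end.

Local Notation gds_switch := generalised_dual_seidel_switch.

Section GeneralisedDualSeidelSwitch.

Variables (p q : nat) (phi : {perm 'I_p}).
Implicit Types e : rel 'I_(p + q).

Lemma gds_switch_lshift e i j :
  gds_switch phi e (lshift q i) (lshift q j)
    = dual_seidel_switch phi (induced_left e) i j.
Proof. by rewrite /gds_switch (unsplitK (inl i)) (unsplitK (inl j)). Qed.

Lemma gds_switch_rshiftl e j v :
  gds_switch phi e (rshift p j) v = e (rshift p j) v.
Proof. by rewrite /gds_switch (unsplitK (inr j)). Qed.

Lemma gds_switch_rshiftr e u j :
  gds_switch phi e u (rshift p j) = e u (rshift p j).
Proof. by rewrite /gds_switch (unsplitK (inr j)); case: split. Qed.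

Definition gds_switchE :=
  (gds_switch_lshift, gds_switch_rshiftl, gds_switch_rshiftr).

Lemma simple_graph_gds_switch e : simple_graph e ->
  seidel_automorphism (induced_left e) phi -> simple_graph (gds_switch phi e).
Proof.
move=> ge phiS; have [se ie] := ge.
have gH : simple_graph (induced_left e) := simple_graph_relpre (lshift q) ge.
have [sH iH] := simple_graph_dual_seidel_switch gH phiS.
split=> [u v|u]; case: (split_ordP u) => i ->; rewrite ?gds_switchE //.
by case: (split_ordP v) => j ->; rewrite !gds_switchE.
Qed.

Lemma adjmx_gds_switch e A B C D : adjmx e = block_mx A B C D ->
  adjmx (gds_switch phi e) = block_mx (perm_mx phi *m A) B C D.
Proof.
rewrite -row_permE => eE; apply/matrixP => u v; rewrite mxE.
case: (split_ordP u) => i ->; case: (split_ordP v) => j ->; rewrite gds_switchE.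
- by rewrite block_mxEul mxE -(block_mxEul A B C D) -eE mxE.
- by rewrite block_mxEur -(block_mxEur A B C D) -eE mxE.
- by rewrite block_mxEdl -(block_mxEdl A B C D) -eE mxE.
- by rewrite block_mxEdr -(block_mxEdr A B C D) -eE mxE.
Qed.

Lemma adjmx_gds_switch_sq e A B C D : simple_graph e ->
  adjmx e = block_mx A B C D -> seidel_automorphism (induced_left e) phi ->
  perm_mx phi *m A *m B = A *m B ->
  adjmx (gds_switch phi e) *m adjmx (gds_switch phi e) = adjmx e *m adjmx e.
Proof.
move=> [se _] eE [phiA phiK _ _] PAB.
have [trA _ trB _] : [/\ A^T = A, C^T = B, B^T = C & D^T = D].
  by apply: eq_block_mx; rewrite -tr_block_mx -eE tr_adjmx.
have PA : comm_mx (perm_mx phi) A.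
  by rewrite -(adjmx_induced_left eE); apply: automorphism_comm_mx.
have CAP : C *m A *m perm_mx phi = C *m A.
  move/(congr1 trmx): PAB.
  by rewrite !trmx_mul trA trB tr_perm_mx permV_involutive // mulmxA.
rewrite (adjmx_gds_switch eE) eE; apply: switched_block_mx_sq => //.
exact: perm_mx_involutive.
Qed.

Lemma deza_with_src_gds_switch e A B C D : deza_with_src e ->
  adjmx e = block_mx A B C D -> seidel_automorphism (induced_left e) phi ->
  perm_mx phi *m A *m B = A *m B -> (0 < q)%N \/ ~ bipartite e ->
  deza_with_src (gds_switch phi e).
Proof.
move=> dz eE phiS PAB q_or_nbip.
have [ge ce] := deza_with_src_simple_connected dz.
have gf := simple_graph_gds_switch ge phiS.
have eq_sq := esym (adjmx_gds_switch_sq ge eE phiS PAB).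
apply: (deza_with_src_sq gf _ eq_sq dz).
case: q_or_nbip => [q_gt0|nbip].
  pose w := rshift p (Ordinal q_gt0).
  apply: (connected_graph_sq_neighbourhood (w := w) ge.1 gf.1 eq_sq ce) => v.
  by rewrite gds_switch_rshiftl.
exact: (connected_graph_sq_nonbipartite ge.1 gf.1 eq_sq ce nbip).
Qed.

End GeneralisedDualSeidelSwitch.

Theorem theorem7 (p q : nat) (G : rel 'I_(p + q))
    (M11 : 'M[int]_p) (M12 : 'M[int]_(p, q))
    (M21 : 'M[int]_(q, p)) (M22 : 'M[int]_q)
    (phi : {perm 'I_p})
    (hG : deza_with_src G)
    (hM : adjmx G = block_mx M11 M12 M21 M22)
    (hphi : seidel_automorphism (induced_left G) phi)
    (hcomm : perm_mx phi *m M11 *m M12 = M11 *m M12) :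
  let P11 : 'M[int]_p := perm_mx phi in
  let M := block_mx M11 M12 M21 M22 in
  let P := block_mx P11 0 0 1%:M in
  let N1 := block_mx (P11 *m M11) M12 M21 M22 in
  let N2 := block_mx (P11 *m M11) (P11 *m M12) (M21 *m P11) M22 in
  ((0 < q)%N \/ ~ bipartite G ->
     adjmx_of_deza_with_src N1 /\ adjmx_of_deza_with_src N2)
  /\ N1 *m N1 = M *m M
  /\ N2 *m N2 = (P *m M *m P) *m (P *m M *m P).
Proof.
move=> P11 M P N1 N2.
have [gG _] := deza_with_src_simple_connected hG; have [phiA phiK _ _] := hphi.
have N1E := adjmx_gds_switch phi hM; rewrite -/P11 -/N1 in N1E.
have sqN1 : N1 *m N1 = M *m M.
  by rewrite -N1E (adjmx_gds_switch_sq gG hM hphi hcomm) hM.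
pose s := perm_sum phi (1 : {perm 'I_q})%g.
have sK : involutive s by apply: perm_sum_involutive => // j; rewrite !perm1.
have PE : perm_mx s = P by rewrite perm_mx_sum perm_mx1.
have PP : P *m P = 1%:M by rewrite -PE perm_mx_involutive.
have N2E : N2 = P *m N1 *m P.
  rewrite conj_switched_block_mx ?perm_mx_involutive //.
  by rewrite -(adjmx_induced_left hM); apply: automorphism_comm_mx.
split; last by rewrite N2E !conj_mx_mul // sqN1.
move/(deza_with_src_gds_switch hG hM hphi hcomm) => dezaN1; split.
  by exists (gds_switch phi G).
exists (relpre s (gds_switch phi G)).
split; last exact: deza_with_src_relpre.
by rewrite adjmx_relpre N1E permV_involutive // PE.
Qed.
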